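(* Let $(T,m,u)$ be a monad on a monoidal category $(\mathcal M,\otimes,K)$, where $(T,\tau,\tau_0):(\mathcal M,\otimes,K)\to(\mathcal M,\otimes,K)$ is an opmonoidal functor. Then the identities (W1)--(W5) listed in the context hold (for all objects $X,Y,Z$ of $\mathcal M$) if and only if the following conditions are satisfied: (i) The functor $1\xrightarrow{K}\mathcal M\xrightarrow{T}\mathcal M$ and the natural transformation $T^2K\xrightarrow{m_K}TK\xrightarrow{\sqcap}TK$ constitute a 1-cell $1\to T$ in $\mathsf{Mnd}^i(\mathsf{Cat})$ (where $1$ is the identity monad on the terminal category). (ii) The functor $\otimes:\mathcal M\times\mathcal M\to\mathcal M$ and the natural transformation $\tau:T(\bullet\otimes\bullet)\to T(\bullet)\otimes T(\bullet)$ constitute a 1-cell $T\times T\to T$ in $\mathsf{Mnd}^i(\mathsf{Cat})$. (iii) The natural transformations with components $X\otimes\tau_0:X\otimes TK\to X$ and $\tau_0\otimes X:TK\otimes X\to X$ are 2-cells in $\mathsf{Mnd}^i(\mathsf{Cat})$, from the composite 1-cells $T\to T$ on the functors $\bullet\otimes TK$ and $TK\otimes\bullet$, respectively, built from the 1-cells in (i) and (ii), to the identity 1-cell $T\to T$. (iv) The (idempotent) natural transformations $$E_{TX,TY}=(m_X\otimes m_Y)\circ\tau_{TX,TY}\circ u_{TX\otimes TY},$$ $$E^{(3)}_{TX,TY,TZ}=(m_X\otimes m_Y\otimes m_Z)\circ\tau^{(3)}_{TX,TY,TZ}\circ u_{TX\otimes TY\otimes TZ}$$ satisfy, for all objects $X,Y,Z$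 of $\mathcal M$, $$(TX\otimes E_{TY,TZ})\circ(E_{TX,TY}\otimes TZ)=E^{(3)}_{TX,TY,TZ}=(E_{TX,TY}\otimes TZ)\circ(TX\otimes E_{TY,TZ}).$$
   Context: Monoidal categories need not be strict, but coherence isomorphisms are suppressed. An object also denotes its identity morphism. Opmonoidal means: natural $\tau_{X,Y}:T(X\otimes Y)\to TX\otimes TY$ and $\tau_0:TK\to K$, coassociative and counital; $\tau^{(3)}_{X,Y,Z}=(\tau_{X,Y}\otimes TZ)\circ\tau_{X\otimes Y,Z}=(TX\otimes\tau_{Y,Z})\circ\tau_{X,Y\otimes Z}$. The identities are: (W1) $m_X\circ T(TX\otimes\tau_0)\circ T(TX\otimes m_K)\circ T\tau_{X,TK}\circ Tu_{X\otimes TK}=(TX\otimes\tau_0)\circ(TX\otimes m_K)\circ\tau_{X,TK}$; (W2) $m_X\circ T(\tau_0\otimes TX)\circ T(m_K\otimes TX)\circ T\tau_{TK,X}\circ Tu_{TK\otimes X}=(\tau_0\otimes TX)\circ(m_K\otimes TX)\circ\tau_{TK,X}$; (W3) $(TX\otimes m_Y\otimes TZ)\circ(\tau_{X,TY}\otimes TZ)\circ(u_{X\otimes TY}\otimes TZ)\circ(X\otimes\tau_{Y,Z})\circ(X\otimes u_{Y\otimes Z})=(\tau_{X,Y}\otimes TZ)\circ\tau_{X\otimes Y,Z}\circ u_{X\otimes Y\otimes Z}$; (W4) $(TX\otimes m_Y\otimes TZ)\circ(TX\otimes\tau_{TY,Z})\circ(TX\otimes u_{TY\otimes Z})\circ(\tau_{X,Y}\otimes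 Z)\circ(u_{X\otimes Y}\otimes Z)=(\tau_{X,Y}\otimes TZ)\circ\tau_{X\otimes Y,Z}\circ u_{X\otimes Y\otimes Z}$; (W5) $(m_X\otimes m_Y)\circ\tau_{TX,TY}\circ T\tau_{X,Y}=\tau_{X,Y}\circ m_{X\otimes Y}$. The morphism $\sqcap:TK\to TK$ is $\sqcap:=(TK\otimes\tau_0)\circ(TK\otimes m_K)\circ\tau_{K,TK}\circ u_{TK}$. The 2-category $\mathsf{Mnd}^i(\mathsf{Cat})$ has monads in $\mathsf{Cat}$ as objects. A 1-cell from a monad $(T,m,u)$ on $\mathcal C$ to a monad $(T',m',u')$ on $\mathcal C'$ is a pair $(V,\psi)$ of a functor $V:\mathcal C\to\mathcal C'$ and a natural transformation $\psi:T'V\to VT$ with $Vm\circ\psi T\circ T'\psi=\psi\circ m'V$ (no unit condition). A 2-cell $(V,\psi)\to(W,\phi)$ is a natural transformation $\omega:V\to W$ with $Wm\circ\phi T\circ T'\omega T\circ T'\psi\circ T'u'V=\omega T\circ\psi$. The composite of $(V,\psi)$ followed by $(W,\phi)$ is $(WV,W\psi\circ\phi V)$; the identity 1-cell of $T$ is $(\mathrm{id},\mathrm{id}_T)$. $T\times T$ is the evident monad on $\mathcal M\times\mathcal M$. Thus in (iii) the source 1-cell on $\bullet\otimes TK$ has structure $(TX\otimes(\sqcap\circ m_K))\circ\tau_{X,TK}:T(X\otimes TK)\to TX\otimes TK$, and the one on $TK\otimes\bullet$ has structure $((\sqcap\circ m_K)\otimes TX)\circ\tau_{TK,X}$. Idempotency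 of $E$ and $E^{(3)}$ in (iv) follows from (ii). *)

(* Defs.v *)
Set Implicit Arguments.
Unset Strict Implicit.
Unset Printing Implicit Defensive.

Declare Scope cat_scope.
Delimit Scope cat_scope with cat.
Open Scope cat_scope.

(** * Categories, functors, natural transformations *)

Record category := Category {
  obj :> Type;
  hom : obj -> obj -> Type;
  idm : forall X, hom X X;
  comp : forall X Y Z, hom Y Z -> hom X Y -> hom X Z;
  comp_idl : forall X Y (f : hom X Y), comp (idm Y) f = f;
  comp_idr : forall X Y (f : hom X Y), comp f (idm X) = f;
  comp_assoc : forall X Y Z W (h : hom Z W) (g : hom Y Z) (f : hom X Y),
    comp h (comp g f) = comp (comp h g) f
}.
Arguments hom {c} X Y.
Arguments idm {c} X.
Arguments comp {c X Y Z} g f.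

Notation "g ∘ f" := (comp g f) (at level 40, left associativity) : cat_scope.

Record functor (C D : category) := Functor {
  fobj :> C -> D;
  fmap : forall X Y, hom X Y -> hom (fobj X) (fobj Y);
  fmap_id : forall X, fmap (idm X) = idm (fobj X);
  fmap_comp : forall X Y Z (g : hom Y Z) (f : hom X Y),
    fmap (g ∘ f) = fmap g ∘ fmap f
}.
Arguments fmap {C D} F {X Y} f : rename.

Record nat_trans (C D : category) (F G : functor C D) := NatTrans {
  ncomp :> forall X, hom (F X) (G X);
  ncomp_nat : forall X Y (f : hom X Y), fmap G f ∘ ncomp X = ncomp Y ∘ fmap F f
}.
Arguments NatTrans {C D F G} ncomp ncomp_nat.

Definition id_functor (C : category) : functor C C :=
  @Functor C C (fun X => X) (fun _ _ f => f)
    (fun _ => eq_refl) (fun _ _ _ _ _ => eq_refl).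

Definition comp_functor (C D E : category)
  (G : functor D E) (F : functor C D) : functor C E.
Proof.
refine (@Functor C E (fun X => G (F X)) (fun _ _ f => fmap G (fmap F f)) _ _).
- abstract (intros; cbn; now rewrite !fmap_id).
- abstract (intros; cbn; now rewrite !fmap_comp).
Defined.

Notation "G ∘F F" := (comp_functor G F)
  (at level 40, left associativity) : cat_scope.

Definition id_trans (C D : category) (F : functor C D) : nat_trans F F.
Proof.
refine (NatTrans (fun X => idm (F X)) _).
abstract (intros; now rewrite comp_idl, comp_idr).
Defined.

Definition terminal_cat : category.
Proof.
refine (@Category unit (fun _ _ => unit) (fun _ => tt) (fun _ _ _ _ _ => tt)
          _ _ _).
- abstract (intros X Y f; now destruct f).
- abstract (intros X Y f; now destruct f).
- abstract reflexivity.
Defined.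

Definition prod_cat (C D : category) : category.
Proof.
refine (@Category (C * D)%type
  (fun p q => (hom (fst p) (fst q) * hom (snd p) (snd q))%type)
  (fun p => (idm (fst p), idm (snd p)))
  (fun _ _ _ g f => (fst g ∘ fst f, snd g ∘ snd f)) _ _ _).
- abstract (intros X Y [f g]; cbn; now rewrite !comp_idl).
- abstract (intros X Y [f g]; cbn; now rewrite !comp_idr).
- abstract (intros; cbn; now rewrite !comp_assoc).
Defined.

Definition prod_functor (C C' D D' : category)
  (F : functor C D) (G : functor C' D') :
  functor (prod_cat C C') (prod_cat D D').
Proof.
refine (@Functor (prod_cat C C') (prod_cat D D')
  (fun p => (F (fst p), G (snd p)))
  (fun _ _ f => (fmap F (fst f), fmap G (snd f))) _ _).
- abstract (intros; cbn; now rewrite !fmap_id).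
- abstract (intros; cbn; now rewrite !fmap_comp).
Defined.

(** * Monoidal categories *)

Record monoidal_category := MonoidalCategory {
  mcat :> category;
  tensor : functor (prod_cat mcat mcat) mcat;
  tunit : mcat;
  tobj (X Y : mcat) : mcat := tensor (X, Y);
  thom (X X' Y Y' : mcat) (f : hom X X') (g : hom Y Y') :
      hom (tobj X Y) (tobj X' Y') :=
    @fmap _ _ tensor (X, Y) (X', Y') (f, g);
  assoc : forall X Y Z, hom (tobj (tobj X Y) Z) (tobj X (tobj Y Z));
  assoc_inv : forall X Y Z, hom (tobj X (tobj Y Z)) (tobj (tobj X Y) Z);
  lunit : forall X, hom (tobj tunit X) X;
  lunit_inv : forall X, hom X (tobj tunit X);
  runit : forall X, hom (tobj X tunit) X;
  runit_inv : forall X, hom X (tobj X tunit);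
  assocK : forall X Y Z, assoc_inv X Y Z ∘ assoc X Y Z = idm _;
  assocVK : forall X Y Z, assoc X Y Z ∘ assoc_inv X Y Z = idm _;
  lunitK : forall X, lunit_inv X ∘ lunit X = idm _;
  lunitVK : forall X, lunit X ∘ lunit_inv X = idm _;
  runitK : forall X, runit_inv X ∘ runit X = idm _;
  runitVK : forall X, runit X ∘ runit_inv X = idm _;
  assoc_nat : forall X X' Y Y' Z Z'
      (f : hom X X') (g : hom Y Y') (h : hom Z Z'),
    thom f (thom g h) ∘ assoc X Y Z = assoc X' Y' Z' ∘ thom (thom f g) h;
  lunit_nat : forall X Y (f : hom X Y),
    f ∘ lunit X = lunit Y ∘ thom (idm tunit) f;
  runit_nat : forall X Y (f : hom X Y),
    f ∘ runit X = runit Y ∘ thom f (idm tunit);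
  pentagon : forall X Y Z W,
    assoc X Y (tobj Z W) ∘ assoc (tobj X Y) Z W
    = thom (idm X) (assoc Y Z W) ∘ assoc X (tobj Y Z) W
        ∘ thom (assoc X Y Z) (idm W);
  triangle : forall X Y,
    thom (idm X) (lunit Y) ∘ assoc X tunit Y = thom (runit X) (idm Y)
}.
Arguments tobj {m} X Y.
Arguments thom {m X X' Y Y'} f g.
Arguments assoc {m} X Y Z.
Arguments assoc_inv {m} X Y Z.
Arguments lunit {m} X.
Arguments lunit_inv {m} X.
Arguments runit {m} X.
Arguments runit_inv {m} X.

Notation "X ⊗ Y" := (tobj X Y) (at level 38, left associativity) : cat_scope.
Notation "f ⊗₁ g" := (thom f g) (at level 38, left associativity) : cat_scope.
Notation "X ◁ f" := (thom (idm X) f) (at level 37, right associativity) : cat_scope.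
Notation "f ▷ X" := (thom f (idm X)) (at level 36, left associativity) : cat_scope.

Section TensorFacts.
Variable M : monoidal_category.

Lemma thom_id (X Y : M) : idm X ⊗₁ idm Y = idm (X ⊗ Y).
Proof. exact (@fmap_id _ _ (tensor M) (X, Y)). Qed.

Lemma thom_comp (X X' X'' Y Y' Y'' : M) (f' : hom X' X'') (f : hom X X')
    (g' : hom Y' Y'') (g : hom Y Y') :
  (f' ∘ f) ⊗₁ (g' ∘ g) = (f' ⊗₁ g') ∘ (f ⊗₁ g).
Proof.
exact (@fmap_comp _ _ (tensor M) (X, Y) (X', Y') (X'', Y'') (f', g') (f, g)).
Qed.

End TensorFacts.

(** * Monads and opmonoidal functors *)

Record monad (C : category) := Monad {
  mfun :> functor C C;
  mmul : nat_trans (mfun ∘F mfun) mfun;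
  munit : nat_trans (id_functor C) mfun;
  mmul_assoc : forall X, mmul X ∘ fmap mfun (mmul X) = mmul X ∘ mmul (mfun X);
  mmul_unitl : forall X, mmul X ∘ munit (mfun X) = idm (mfun X);
  mmul_unitr : forall X, mmul X ∘ fmap mfun (munit X) = idm (mfun X)
}.

Record opmonoidal (M : monoidal_category) (F : functor M M) := Opmonoidal {
  optau : nat_trans (F ∘F tensor M) (tensor M ∘F prod_functor F F);
  tau (X Y : M) : hom (F (X ⊗ Y)) (F X ⊗ F Y) := optau (X, Y);
  tau0 : hom (F (tunit M)) (tunit M);
  tau_coassoc : forall X Y Z : M,
    assoc (F X) (F Y) (F Z) ∘ (tau X Y ▷ F Z) ∘ tau (X ⊗ Y) Z
    = (F X ◁ tau Y Z) ∘ tau X (Y ⊗ Z) ∘ fmap F (assoc X Y Z);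
  tau_counitl : forall X : M,
    lunit (F X) ∘ (tau0 ▷ F X) ∘ tau (tunit M) X = fmap F (lunit X);
  tau_counitr : forall X : M,
    runit (F X) ∘ (F X ◁ tau0) ∘ tau X (tunit M) = fmap F (runit X)
}.
Arguments tau {M F} o X Y.
Arguments tau0 {M F} o.

Definition tau3 (M : monoidal_category) (F : functor M M) (o : opmonoidal F)
    (X Y Z : M) : hom (F (X ⊗ Y ⊗ Z)) (F X ⊗ F Y ⊗ F Z) :=
  (tau o X Y ▷ F Z) ∘ tau o (X ⊗ Y) Z.

Definition id_monad (C : category) : monad C.
Proof.
refine (@Monad C (id_functor C)
  (@NatTrans C C (id_functor C ∘F id_functor C) (id_functor C)
     (fun X => idm X) (ncomp_nat (id_trans (id_functor C))))
  (id_trans (id_functor C)) _ _ _).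
all: abstract (intros; cbn; now rewrite ?comp_idl).
Defined.

Definition prod_monad (C D : category) (T : monad C) (S : monad D) :
  monad (prod_cat C D).
Proof.
refine (@Monad (prod_cat C D) (prod_functor T S)
  (@NatTrans (prod_cat C D) (prod_cat C D)
     (prod_functor T S ∘F prod_functor T S) (prod_functor T S)
     (fun p => (mmul T (fst p), mmul S (snd p)))
     (fun p q f => f_equal2 pair
        (ncomp_nat (mmul T) (fst f)) (ncomp_nat (mmul S) (snd f))))
  (@NatTrans (prod_cat C D) (prod_cat C D)
     (id_functor (prod_cat C D)) (prod_functor T S)
     (fun p => (munit T (fst p), munit S (snd p)))
     (fun p q f => f_equal2 pair
        (ncomp_nat (munit T) (fst f)) (ncomp_nat (munit S) (snd f)))) _ _ _).
- abstract (intros p; exact (f_equal2 pair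
    (mmul_assoc T (fst p)) (mmul_assoc S (snd p)))).
- abstract (intros p; exact (f_equal2 pair
    (mmul_unitl T (fst p)) (mmul_unitl S (snd p)))).
- abstract (intros p; exact (f_equal2 pair
    (mmul_unitr T (fst p)) (mmul_unitr S (snd p)))).
Defined.

(** * The 2-category Mnd^i(Cat) *)

(* The pair [(V, psi)] underlying a 1-cell; its law is [is_1cell]. Keeping the
   two apart lets one form a composite before its factors are known to be
   1-cells. *)
Record cell_data (C D : category) (T : monad C) (S : monad D) := CellData {
  cfun :> functor C D;
  cstr : nat_trans (S ∘F cfun) (cfun ∘F T)
}.

Definition is_1cell (C D : category) (T : monad C) (S : monad D)
    (V : cell_data T S) : Prop :=
  forall X : C,
    fmap V (mmul T X) ∘ cstr V (T X) ∘ fmap S (cstr V X)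
    = cstr V X ∘ mmul S (V X).

Definition is_2cell (C D : category) (T : monad C) (S : monad D)
    (V W : cell_data T S) (w : nat_trans V W) : Prop :=
  is_1cell V /\ is_1cell W /\
  forall X : C,
    fmap W (mmul T X) ∘ cstr W (T X) ∘ fmap S (w (T X)) ∘ fmap S (cstr V X)
      ∘ fmap S (munit S (V X))
    = w (T X) ∘ cstr V X.

Definition id_cell (C : category) (T : monad C) : cell_data T T.
Proof.
refine (@CellData C C T T (id_functor C)
  (@NatTrans C C (T ∘F id_functor C) (id_functor C ∘F T)
     (fun X => idm (T X)) _)).
abstract (intros; cbn; now rewrite comp_idl, comp_idr).
Defined.

(* [comp_cell W V] is [V] followed by [W]. *)
Definition comp_cell (C D E : category) (T : monad C) (S : monad D)
  (R : monad E) (W : cell_data S R) (V : cell_data T S) : cell_data T R.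
Proof.
refine (@CellData C E T R (W ∘F V)
  (@NatTrans C E (R ∘F (W ∘F V)) ((W ∘F V) ∘F T)
     (fun X => fmap W (cstr V X) ∘ cstr W (V X)) _)).
abstract (intros X Y f; cbn; rewrite comp_assoc, <- fmap_comp;
  pose proof (ncomp_nat (cstr V) f) as HV; cbn in HV; rewrite HV;
  rewrite fmap_comp, <- !comp_assoc;
  pose proof (ncomp_nat (cstr W) (fmap V f)) as HW; cbn in HW;
  now rewrite HW).
Defined.

Definition prod_cell (C C' D D' : category) (T : monad C) (T' : monad C')
  (S : monad D) (S' : monad D') (V : cell_data T S) (W : cell_data T' S') :
  cell_data (prod_monad T T') (prod_monad S S').
Proof.
refine (@CellData _ _ (prod_monad T T') (prod_monad S S') (prod_functor V W)
  (@NatTrans (prod_cat C C') (prod_cat D D')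
     (prod_monad S S' ∘F prod_functor V W)
     (prod_functor V W ∘F prod_monad T T')
     (fun p => (cstr V (fst p), cstr W (snd p))) _)).
abstract (intros p q f; exact (f_equal2 pair
  (ncomp_nat (cstr V) (fst f)) (ncomp_nat (cstr W) (snd f)))).
Defined.

(* The canonical isomorphisms T -> T x 1 and T -> 1 x T. *)
Definition insr_cell (C : category) (T : monad C) :
  cell_data T (prod_monad T (id_monad terminal_cat)).
Proof.
pose (V := @Functor C (prod_cat C terminal_cat) (fun X => (X, tt))
  (fun _ _ f => (f, tt)) (fun _ => eq_refl) (fun _ _ _ _ _ => eq_refl)).
refine (@CellData _ _ T (prod_monad T (id_monad terminal_cat)) V
  (@NatTrans _ _ (prod_monad T (id_monad terminal_cat) ∘F V) (V ∘F T)
     (fun X => (idm (T X), tt)) _)).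
abstract (intros X Y f; cbn; now rewrite comp_idl, comp_idr).
Defined.

Definition insl_cell (C : category) (T : monad C) :
  cell_data T (prod_monad (id_monad terminal_cat) T).
Proof.
pose (V := @Functor C (prod_cat terminal_cat C) (fun X => (tt, X))
  (fun _ _ f => (tt, f)) (fun _ => eq_refl) (fun _ _ _ _ _ => eq_refl)).
refine (@CellData _ _ T (prod_monad (id_monad terminal_cat) T) V
  (@NatTrans _ _ (prod_monad (id_monad terminal_cat) T ∘F V) (V ∘F T)
     (fun X => (tt, idm (T X))) _)).
abstract (intros X Y f; cbn; now rewrite comp_idl, comp_idr).
Defined.

Lemma id_cell_1cell (C : category) (T : monad C) : is_1cell (id_cell T).
Proof. intros X; cbn. now rewrite fmap_id, !comp_idr, comp_idl. Qed.

Lemma comp_cell_1cell (C D E : category) (T : monad C) (S : monad D)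
    (R : monad E) (W : cell_data S R) (V : cell_data T S) :
  is_1cell V -> is_1cell W -> is_1cell (comp_cell W V).
Proof.
intros hV hW X.
pose proof (ncomp_nat (cstr W) (cstr V X)) as HN.
pose proof (hV X) as HV; pose proof (hW (V X)) as HW.
cbn in HN, HV, HW |- *.
rewrite fmap_comp, !comp_assoc, <- fmap_comp.
rewrite <- (comp_assoc _ (cstr W (V (T X)))).
cbn.
rewrite <- HN, !comp_assoc, <- !fmap_comp, HV, fmap_comp, <- !comp_assoc.
f_equal; rewrite comp_assoc; exact HW.
Qed.

Lemma prod_cell_1cell (C C' D D' : category) (T : monad C) (T' : monad C')
    (S : monad D) (S' : monad D') (V : cell_data T S) (W : cell_data T' S') :
  is_1cell V -> is_1cell W -> is_1cell (prod_cell V W).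
Proof. intros hV hW p; exact (f_equal2 pair (hV (fst p)) (hW (snd p))). Qed.

Lemma insr_cell_1cell (C : category) (T : monad C) : is_1cell (insr_cell T).
Proof. intros X; cbn. now rewrite fmap_id, !comp_idr, comp_idl. Qed.

Lemma insl_cell_1cell (C : category) (T : monad C) : is_1cell (insl_cell T).
Proof. intros X; cbn. now rewrite fmap_id, !comp_idr, comp_idl. Qed.

(** * Constructions on an opmonoidal monad *)

(* Only the functor [T] is required to be opmonoidal: no compatibility of
   [tau], [tau0] with [mmul] or [munit] is assumed. *)
Section OpmonoidalMonad.
Variables (M : monoidal_category) (T : monad M) (o : opmonoidal T).
Notation K := (tunit M).

Definition sqcap : hom (T K) (T K) :=
  runit (T K) ∘ (T K ◁ tau0 o) ∘ (T K ◁ mmul T K) ∘ tau o K (T K)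
    ∘ fmap T (lunit_inv (T K)) ∘ munit T (T K).

Definition const_functor (C : category) (X : C) : functor terminal_cat C.
Proof.
refine (@Functor terminal_cat C (fun _ => X) (fun _ _ _ => idm X) _ _).
- abstract reflexivity.
- abstract (intros; now rewrite comp_idl).
Defined.

Definition unit_cell : cell_data (id_monad terminal_cat) T.
Proof.
pose (V := T ∘F const_functor K).
refine (@CellData _ _ (id_monad terminal_cat) T V
  (@NatTrans _ _ (T ∘F V) (V ∘F id_monad terminal_cat)
     (fun _ => sqcap ∘ mmul T K) _)).
abstract (intros X Y f; cbn; rewrite !fmap_id; now rewrite comp_idl, comp_idr).
Defined.

Definition tensor_cell : cell_data (prod_monad T T) T :=
  @CellData _ _ (prod_monad T T) T (tensor M) (optau o).

(* T -> T x 1 -> T x T -> T *)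
Definition tensor_TK_cell : cell_data T T :=
  comp_cell tensor_cell
    (comp_cell (prod_cell (id_cell T) unit_cell) (insr_cell T)).

(* T -> 1 x T -> T x T -> T *)
Definition TK_tensor_cell : cell_data T T :=
  comp_cell tensor_cell
    (comp_cell (prod_cell unit_cell (id_cell T)) (insl_cell T)).

Lemma tensor_TK_cellE (X : M) :
  cstr tensor_TK_cell X = (T X ◁ (sqcap ∘ mmul T K)) ∘ tau o X (T K).
Proof.
unfold tau, thom; cbn; f_equal. now rewrite fmap_id, !comp_idl.
Qed.

Lemma TK_tensor_cellE (X : M) :
  cstr TK_tensor_cell X = ((sqcap ∘ mmul T K) ▷ T X) ∘ tau o (T K) X.
Proof.
unfold tau, thom; cbn; f_equal. now rewrite fmap_id, !comp_idl.
Qed.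

Lemma tensor_TK_1cell :
  is_1cell unit_cell -> is_1cell tensor_cell -> is_1cell tensor_TK_cell.
Proof.
intros hK ht. apply comp_cell_1cell; [apply comp_cell_1cell|exact ht].
- apply insr_cell_1cell.
- apply prod_cell_1cell; [apply id_cell_1cell|exact hK].
Qed.

Lemma TK_tensor_1cell :
  is_1cell unit_cell -> is_1cell tensor_cell -> is_1cell TK_tensor_cell.
Proof.
intros hK ht. apply comp_cell_1cell; [apply comp_cell_1cell|exact ht].
- apply insl_cell_1cell.
- apply prod_cell_1cell; [exact hK|apply id_cell_1cell].
Qed.

Definition counitr_trans : nat_trans tensor_TK_cell (id_cell T).
Proof.
refine (@NatTrans M M tensor_TK_cell (id_cell T)
  (fun X : M => runit X ∘ (X ◁ tau0 o)) _).
abstract (intros X Y f;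
  change (f ∘ (runit X ∘ (X ◁ tau0 o))
    = runit Y ∘ (Y ◁ tau0 o) ∘ (f ⊗₁ fmap T (idm K)));
  rewrite comp_assoc, runit_nat, <- !comp_assoc, <- !thom_comp, fmap_id;
  now rewrite !comp_idl, !comp_idr).
Defined.

Definition counitl_trans : nat_trans TK_tensor_cell (id_cell T).
Proof.
refine (@NatTrans M M TK_tensor_cell (id_cell T)
  (fun X : M => lunit X ∘ (tau0 o ▷ X)) _).
abstract (intros X Y f;
  change (f ∘ (lunit X ∘ (tau0 o ▷ X))
    = lunit Y ∘ (tau0 o ▷ Y) ∘ (fmap T (idm K) ⊗₁ f));
  rewrite comp_assoc, lunit_nat, <- !comp_assoc, <- !thom_comp, fmap_id;
  now rewrite !comp_idl, !comp_idr).
Defined.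

(* [idemE X Y] and [idemE3 X Y Z] are E and E^(3) at the free objects
   [T X], [T Y], [T Z]. *)
Definition idemE (X Y : M) : hom (T X ⊗ T Y) (T X ⊗ T Y) :=
  (mmul T X ⊗₁ mmul T Y) ∘ tau o (T X) (T Y) ∘ munit T (T X ⊗ T Y).

Definition idemE3 (X Y Z : M) : hom (T X ⊗ T Y ⊗ T Z) (T X ⊗ T Y ⊗ T Z) :=
  (mmul T X ⊗₁ mmul T Y ⊗₁ mmul T Z) ∘ tau3 o (T X) (T Y) (T Z)
    ∘ munit T (T X ⊗ T Y ⊗ T Z).

(* [T X ⊗ E] transported along the associator. *)
Definition idemE_right (X Y Z : M) :
    hom (T X ⊗ T Y ⊗ T Z) (T X ⊗ T Y ⊗ T Z) :=
  assoc_inv (T X) (T Y) (T Z) ∘ (T X ◁ idemE Y Z) ∘ assoc (T X) (T Y) (T Z).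

End OpmonoidalMonad.

(* Main.v *)
(** (W5) is (ii) verbatim. By naturality and the unit laws, each of (W3), (W4)
    is equivalent to one of the equalities in (iv): multiply by [m ⊗ m ⊗ m] in
    one direction, precompose with [u ⊗ u ⊗ u] in the other. Since
    [τ0 ∘ ⊓ = τ0] by counitality, the 2-cell equations of (iii) are (W1) and
    (W2). Finally (W1) at [K] together with counitality yields
    [τ0 ∘ m ∘ T⊓ = τ0 ∘ m], whence [⊓ ∘ m ∘ T⊓ = ⊓ ∘ m], which is (i). *)

Require Import Defs.

Set Implicit Arguments.
Unset Strict Implicit.
Unset Printing Implicit Defensive.

(** * Coherence facts about associators and unitors *)

Section Coherence.
Variable M : monoidal_category.
Notation K := (tunit M).

Lemma assoc_inv_nat (X X' Y Y' Z Z' : M)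
    (f : hom X X') (g : hom Y Y') (h : hom Z Z') :
  (f ⊗₁ g ⊗₁ h) ∘ assoc_inv X Y Z = assoc_inv X' Y' Z' ∘ (f ⊗₁ (g ⊗₁ h)).
Proof.
rewrite <- (comp_idl (f ⊗₁ g ⊗₁ h)), <- assocK, <- !comp_assoc; f_equal.
now rewrite comp_assoc, <- assoc_nat, <- comp_assoc, assocVK, comp_idr.
Qed.

Lemma lunit_inv_nat (X Y : M) (f : hom X Y) :
  lunit_inv Y ∘ f = (K ◁ f) ∘ lunit_inv X.
Proof.
rewrite <- (comp_idl (K ◁ f)), <- lunitK, <- !comp_assoc; f_equal.
now rewrite comp_assoc, <- lunit_nat, <- comp_assoc, lunitVK, comp_idr.
Qed.

(** Naturality of the invertible [lunit] makes [f] a conjugate of [K ◁ f]. *)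
Lemma lwhisker_inj (X Y : M) (f g : hom X Y) : K ◁ f = K ◁ g -> f = g.
Proof.
intros H.
rewrite <- (comp_idr f), <- (comp_idr g), <- lunitVK, !comp_assoc.
now rewrite !lunit_nat, H.
Qed.

Lemma rwhisker_inj (X Y : M) (f g : hom X Y) : f ▷ K = g ▷ K -> f = g.
Proof.
intros H.
rewrite <- (comp_idr f), <- (comp_idr g), <- runitVK, !comp_assoc.
now rewrite !runit_nat, H.
Qed.

Lemma assoc_epi (X Y Z W : M) (f g : hom (X ⊗ (Y ⊗ Z)) W) :
  f ∘ assoc X Y Z = g ∘ assoc X Y Z -> f = g.
Proof.
intros H.
now rewrite <- (comp_idr f), <- (comp_idr g), <- assocVK, !comp_assoc, H.
Qed.

Lemma assoc_rwhisker_epi (X Y Z W V : M) (f g : hom (X ⊗ (Y ⊗ Z) ⊗ W) V) :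
  f ∘ (assoc X Y Z ▷ W) = g ∘ (assoc X Y Z ▷ W) -> f = g.
Proof.
intros H.
assert (E : (assoc X Y Z ▷ W) ∘ (assoc_inv X Y Z ▷ W) = idm _)
  by now rewrite <- thom_comp, assocVK, comp_idl, thom_id.
now rewrite <- (comp_idr f), <- (comp_idr g), <- E, !comp_assoc, H.
Qed.

(* Kelly's redundant axiom: whisker with [K] and compare both sides via the
   pentagon on [K, K, X, Y]. *)
Lemma lunit_tensor (X Y : M) : lunit (X ⊗ Y) ∘ assoc K X Y = lunit X ▷ Y.
Proof.
apply lwhisker_inj, assoc_epi, assoc_rwhisker_epi.
rewrite <- (comp_idl (idm K)), thom_comp, comp_idl.
rewrite <- !comp_assoc, (comp_assoc (K ◁ assoc K X Y)), <- pentagon.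
rewrite comp_assoc, triangle, comp_assoc, assoc_nat.
rewrite <- comp_assoc, <- thom_comp, comp_idl, triangle.
now rewrite <- (thom_id X Y), assoc_nat.
Qed.

(** After whiskering with [K], the triangle and [lunit_tensor] turn the two sides into [K ◁ lunit K]
    and [lunit (K ⊗ K)], each after the same associator. *)
Lemma runit_lunit_unit : runit K = lunit K.
Proof.
apply rwhisker_inj.
rewrite <- triangle, <- lunit_tensor; f_equal.
(* Naturality of [lunit] at the invertible map [lunit K] itself identifies the two. *)
rewrite <- (comp_idl (K ◁ lunit K)), <- lunitK, <- comp_assoc, <- lunit_nat.
now rewrite comp_assoc, lunitK, comp_idl.
Qed.

End Coherence.

(** * Naturality of the structure maps and of their composites with the unit *)

Section OpmonoidalMonadFacts.
Variables (M : monoidal_category) (T : monad M) (o : opmonoidal T).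
Notation K := (tunit M).

Lemma mmul_nat (X Y : M) (f : hom X Y) :
  fmap T f ∘ mmul T X = mmul T Y ∘ fmap T (fmap T f).
Proof. exact (ncomp_nat (mmul T) f). Qed.

Lemma munit_nat (X Y : M) (f : hom X Y) :
  fmap T f ∘ munit T X = munit T Y ∘ f.
Proof. exact (ncomp_nat (munit T) f). Qed.

Lemma tau_nat (X X' Y Y' : M) (f : hom X X') (g : hom Y Y') :
  (fmap T f ⊗₁ fmap T g) ∘ tau o X Y = tau o X' Y' ∘ fmap T (f ⊗₁ g).
Proof. exact (@ncomp_nat _ _ _ _ (optau o) (X, Y) (X', Y') (f, g)). Qed.

(** Bundled with the unit, [tau] becomes a natural map out of [X ⊗ Y] itself; in this form it enters
    E, (W3) and (W4). *)
Definition tauu (X Y : M) : hom (X ⊗ Y) (T X ⊗ T Y) :=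
  tau o X Y ∘ munit T (X ⊗ Y).

Lemma tauu_nat (X X' Y Y' : M) (f : hom X X') (g : hom Y Y') :
  (fmap T f ⊗₁ fmap T g) ∘ tauu X Y = tauu X' Y' ∘ (f ⊗₁ g).
Proof.
unfold tauu; rewrite comp_assoc, tau_nat, <- !comp_assoc; f_equal.
apply munit_nat.
Qed.

Definition tau3u (X Y Z : M) : hom (X ⊗ Y ⊗ Z) (T X ⊗ T Y ⊗ T Z) :=
  tau3 o X Y Z ∘ munit T (X ⊗ Y ⊗ Z).

Lemma tau3u_nat (X X' Y Y' Z Z' : M)
    (f : hom X X') (g : hom Y Y') (h : hom Z Z') :
  (fmap T f ⊗₁ fmap T g ⊗₁ fmap T h) ∘ tau3u X Y Z
  = tau3u X' Y' Z' ∘ (f ⊗₁ g ⊗₁ h).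
Proof.
unfold tau3u, tau3.
rewrite !comp_assoc, <- thom_comp, tau_nat, comp_idr.
rewrite <- (comp_idl (fmap T h)), thom_comp, <- !comp_assoc; f_equal.
rewrite comp_assoc, tau_nat, <- !comp_assoc; f_equal.
apply munit_nat.
Qed.

(** * E and E^(3) precomposed with units *)

Lemma idemE_tauu (X Y : M) :
  idemE o X Y = (mmul T X ⊗₁ mmul T Y) ∘ tauu (T X) (T Y).
Proof. unfold idemE, tauu; now rewrite comp_assoc. Qed.

(** Sent through [tauu], the unit cancels the multiplication on the first factor only; the surviving
    [mmul T Y] is the one in (W3). *)
Lemma idemE_munitl (X Y : M) :
  idemE o X Y ∘ (munit T X ▷ T Y) = (T X ◁ mmul T Y) ∘ tauu X (T Y).
Proof.
rewrite idemE_tauu, <- comp_assoc, <- tauu_nat, comp_assoc, <- thom_comp.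
now rewrite mmul_unitr, fmap_id, comp_idr.
Qed.

Lemma idemE_munitr (X Y : M) :
  idemE o X Y ∘ (T X ◁ munit T Y) = (mmul T X ▷ T Y) ∘ tauu (T X) Y.
Proof.
rewrite idemE_tauu, <- comp_assoc, <- tauu_nat, comp_assoc, <- thom_comp.
now rewrite mmul_unitr, fmap_id, comp_idr.
Qed.

Lemma idemE_munit (X Y : M) :
  idemE o X Y ∘ (munit T X ⊗₁ munit T Y) = tauu X Y.
Proof.
rewrite idemE_tauu, <- comp_assoc, <- tauu_nat, comp_assoc, <- thom_comp.
now rewrite !mmul_unitr, thom_id, comp_idl.
Qed.

Lemma idemE3_tau3u (X Y Z : M) :
  idemE3 o X Y Z
  = (mmul T X ⊗₁ mmul T Y ⊗₁ mmul T Z) ∘ tau3u (T X) (T Y) (T Z).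
Proof. unfold idemE3, tau3u; now rewrite comp_assoc. Qed.

Lemma idemE3_munit (X Y Z : M) :
  idemE3 o X Y Z ∘ (munit T X ⊗₁ munit T Y ⊗₁ munit T Z) = tau3u X Y Z.
Proof.
rewrite idemE3_tau3u, <- comp_assoc, <- tau3u_nat, comp_assoc, <- !thom_comp.
now rewrite !mmul_unitr, !thom_id, comp_idl.
Qed.

(** * (W3) and (W4) versus the two equalities of (iv) *)

Definition W3_lhs (X Y Z : M) : hom (X ⊗ Y ⊗ Z) (T X ⊗ T Y ⊗ T Z) :=
  (((T X ◁ mmul T Y) ∘ tauu X (T Y)) ▷ T Z) ∘ assoc_inv X (T Y) (T Z)
    ∘ (X ◁ tauu Y Z) ∘ assoc X Y Z.

Definition W4_lhs (X Y Z : M) : hom (X ⊗ Y ⊗ Z) (T X ⊗ T Y ⊗ T Z) :=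
  assoc_inv (T X) (T Y) (T Z) ∘ (T X ◁ ((mmul T Y ▷ T Z) ∘ tauu (T Y) Z))
    ∘ assoc (T X) (T Y) Z ∘ (tauu X Y ▷ Z).

(** The inner E meets two units and collapses to [tauu Y Z]; the outer one meets only the unit at
    [X] and so retains the multiplication at [Y]. *)
Lemma W3_lhs_idemE (X Y Z : M) :
  (idemE o X Y ▷ T Z) ∘ idemE_right o X Y Z
      ∘ (munit T X ⊗₁ munit T Y ⊗₁ munit T Z)
  = W3_lhs X Y Z.
Proof.
unfold W3_lhs, idemE_right.
rewrite <- !comp_assoc, <- assoc_nat, (comp_assoc (T X ◁ _)), <- thom_comp.
rewrite idemE_munit, comp_idl.
(* The unit at [X] is split off from [tauu Y Z], so that it can cross the associator and reach the
   outer E. *)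
rewrite <- (comp_idr (munit T X)), <- (comp_idl (tauu Y Z)), thom_comp.
rewrite !comp_assoc, <- (thom_id (T Y)), <- (comp_assoc _ (assoc_inv _ _ _)).
rewrite <- assoc_inv_nat, !comp_assoc, <- thom_comp, idemE_munitl.
now rewrite thom_id, !comp_idl.
Qed.

Lemma W4_lhs_idemE (X Y Z : M) :
  idemE_right o X Y Z ∘ (idemE o X Y ▷ T Z)
      ∘ (munit T X ⊗₁ munit T Y ⊗₁ munit T Z)
  = W4_lhs X Y Z.
Proof.
unfold W4_lhs, idemE_right.
rewrite <- !comp_assoc, <- thom_comp, idemE_munit, comp_idl.
rewrite <- (comp_idl (tauu X Y)), <- (comp_idr (munit T Z)), thom_comp.
rewrite comp_idl, <- (thom_id (T X)), (comp_assoc _ (_ ⊗₁ munit T Z)).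
rewrite <- assoc_nat, !comp_assoc, <- (comp_assoc (assoc_inv _ _ _)).
now rewrite <- thom_comp, idemE_munitr, comp_idl.
Qed.

(** Associativity replaces the inner multiplication by [fmap T (mmul T Y)], which then slides
    through [tauu]. *)
Lemma idemE_mmulr (X Y : M) :
  (mmul T X ⊗₁ (mmul T Y ∘ mmul T (T Y))) ∘ tauu (T X) (T (T Y))
  = idemE o X Y ∘ (T X ◁ mmul T Y).
Proof.
rewrite <- mmul_assoc, idemE_tauu, <- comp_assoc, <- tauu_nat, comp_assoc.
now rewrite <- thom_comp, fmap_id, comp_idr.
Qed.

Lemma idemE_mmull (X Y : M) :
  ((mmul T X ∘ mmul T (T X)) ⊗₁ mmul T Y) ∘ tauu (T (T X)) (T Y)
  = idemE o X Y ∘ (mmul T X ▷ T Y).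
Proof.
rewrite <- mmul_assoc, idemE_tauu, <- comp_assoc, <- tauu_nat, comp_assoc.
now rewrite <- thom_comp, fmap_id, comp_idr.
Qed.

(** On the middle factor the multiplication of (W3) is followed by a second one. By [idemE_mmulr]
    the pair yields the outer E and leaves one multiplication, which crosses the associator and
    completes the inner E. *)
Lemma mmul_W3_lhs (X Y Z : M) :
  (mmul T X ⊗₁ mmul T Y ⊗₁ mmul T Z) ∘ W3_lhs (T X) (T Y) (T Z)
  = (idemE o X Y ▷ T Z) ∘ idemE_right o X Y Z.
Proof.
unfold W3_lhs, idemE_right.
rewrite !comp_assoc, <- thom_comp, comp_assoc, <- thom_comp, !comp_idr.
rewrite idemE_mmulr.
rewrite <- (comp_idl (mmul T Z)), thom_comp.
rewrite <- (comp_assoc _ _ (assoc_inv _ _ _)), assoc_inv_nat, <- !comp_assoc.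
do 2 f_equal.
now rewrite comp_assoc, <- thom_comp, comp_idl, <- idemE_tauu.
Qed.

Lemma mmul_W4_lhs (X Y Z : M) :
  (mmul T X ⊗₁ mmul T Y ⊗₁ mmul T Z) ∘ W4_lhs (T X) (T Y) (T Z)
  = idemE_right o X Y Z ∘ (idemE o X Y ▷ T Z).
Proof.
unfold W4_lhs, idemE_right.
rewrite !comp_assoc, assoc_inv_nat, <- !comp_assoc; f_equal.
rewrite comp_assoc, <- thom_comp, (comp_assoc (_ ⊗₁ _) (_ ▷ _)), <- thom_comp.
rewrite !comp_idr.
rewrite idemE_mmull.
rewrite <- (comp_idl (mmul T X)), thom_comp.
rewrite <- comp_assoc; f_equal.
rewrite comp_assoc, assoc_nat, <- comp_assoc; f_equal.
now rewrite <- thom_comp, comp_idl, <- idemE_tauu.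
Qed.

Lemma W3_iff_idemE :
  (forall X Y Z, W3_lhs X Y Z = tau3u X Y Z)
  <-> (forall X Y Z, (idemE o X Y ▷ T Z) ∘ idemE_right o X Y Z
                     = idemE3 o X Y Z).
Proof.
split; intros H X Y Z.
- now rewrite <- mmul_W3_lhs, H, idemE3_tau3u.
- now rewrite <- W3_lhs_idemE, H, idemE3_munit.
Qed.

Lemma W4_iff_idemE :
  (forall X Y Z, W4_lhs X Y Z = tau3u X Y Z)
  <-> (forall X Y Z, idemE_right o X Y Z ∘ (idemE o X Y ▷ T Z)
                     = idemE3 o X Y Z).
Proof.
split; intros H X Y Z.
- now rewrite <- mmul_W4_lhs, H, idemE3_tau3u.
- now rewrite <- W4_lhs_idemE, H, idemE3_munit.
Qed.

(** * Counits, the morphism ⊓ and condition (i) *)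

(** With this map as [r], (W1) reads [m ∘ T(r ∘ u) = r]: it is the morphism of free algebras that
    extends its own restriction along the unit. *)
Definition rcounit_mul (X : M) : hom (T (X ⊗ T K)) (T X) :=
  runit (T X) ∘ (T X ◁ (tau0 o ∘ mmul T K)) ∘ tau o X (T K).

Definition lcounit_mul (X : M) : hom (T (T K ⊗ X)) (T X) :=
  lunit (T X) ∘ ((tau0 o ∘ mmul T K) ▷ T X) ∘ tau o (T K) X.

(** This links ⊓ to (W1) at [K], which thereby computes [mmul T K ∘ fmap T (sqcap o)]. *)
Lemma sqcap_rcounit_mul :
  sqcap o = rcounit_mul K ∘ fmap T (lunit_inv (T K)) ∘ munit T (T K).
Proof.
unfold sqcap, rcounit_mul.
rewrite <- (comp_assoc _ (_ ◁ tau0 o)), <- thom_comp.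
now rewrite comp_idl.
Qed.

(** The unit is exchanged with [lunit_inv] so that [tauu_nat] can carry maps through ⊓. *)
Lemma sqcap_tauu :
  sqcap o = runit (T K) ∘ (T K ◁ (tau0 o ∘ mmul T K)) ∘ tauu K (T K)
              ∘ lunit_inv (T K).
Proof.
rewrite sqcap_rcounit_mul; unfold rcounit_mul, tauu.
rewrite <- !comp_assoc; do 3 f_equal; apply munit_nat.
Qed.

(** Once [tau0] slides past [runit], the two counits act on separate factors before [runit K]. Since
    [runit K = lunit K], left counitality can absorb the first one. *)
Lemma tau0_rcounit_mul :
  tau0 o ∘ rcounit_mul K = tau0 o ∘ mmul T K ∘ fmap T (lunit (T K)).
Proof.
unfold rcounit_mul.
rewrite !comp_assoc, runit_nat, runit_lunit_unit.
rewrite <- (comp_assoc (lunit K)), <- thom_comp, comp_idl, comp_idr.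
rewrite <- (tau_counitl o), !comp_assoc, lunit_nat.
rewrite <- (comp_assoc (lunit K) _ (tau0 o ▷ _)), <- thom_comp.
now rewrite comp_idl, comp_idr.
Qed.

Lemma tau0_sqcap : tau0 o ∘ sqcap o = tau0 o.
Proof.
rewrite sqcap_rcounit_mul, !comp_assoc, tau0_rcounit_mul.
rewrite <- (comp_assoc _ (fmap T (lunit (T K)))), <- fmap_comp, lunitVK, fmap_id.
now rewrite comp_idr, <- comp_assoc, mmul_unitl, comp_idr.
Qed.

Lemma unit_cell_of_W1 :
  mmul T K ∘ fmap T (rcounit_mul K) ∘ fmap T (munit T (K ⊗ T K))
    = rcounit_mul K ->
  is_1cell (unit_cell o).
Proof.
intros W1.
(* By naturality of the unit, this is (W1) at [K] precomposed with [fmap T (lunit_inv (T K))]. *)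
assert (H : mmul T K ∘ fmap T (sqcap o)
            = rcounit_mul K ∘ fmap T (lunit_inv (T K))).
{ rewrite <- W1, sqcap_rcounit_mul.
  rewrite <- comp_assoc, munit_nat, !fmap_comp, !comp_assoc; reflexivity. }
assert (H0 : tau0 o ∘ mmul T K ∘ fmap T (sqcap o) = tau0 o ∘ mmul T K).
{ rewrite <- comp_assoc, H, comp_assoc, tau0_rcounit_mul.
  rewrite <- (comp_assoc _ (fmap T (lunit (T K)))), <- fmap_comp.
  now rewrite lunitVK, fmap_id, comp_idr. }
(* [sqcap] absorbs a map [f] below the multiplication because it only sees its
   argument through [tau0 ∘ mmul]. *)
assert (S : forall (X : M) (f : hom X (T K)),
   sqcap o ∘ f = runit (T K) ∘ (T K ◁ (tau0 o ∘ mmul T K ∘ fmap T f))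
     ∘ tauu K X ∘ lunit_inv X).
{ intros X f.
  rewrite sqcap_tauu, <- comp_assoc, lunit_inv_nat, !comp_assoc.
  rewrite <- (comp_assoc _ (tauu K (T K))), <- tauu_nat, fmap_id, !comp_assoc.
  now rewrite <- (comp_assoc (runit _)), <- thom_comp, comp_idl. }
(* [S] reduces this to [H0] precomposed with [mmul T (T K)]: associativity and naturality of the
   multiplication move the inner ⊓ into the position where [H0] applies. *)
assert (H1 : sqcap o ∘ mmul T K ∘ fmap T (sqcap o) = sqcap o ∘ mmul T K).
{ rewrite <- comp_assoc, !S; do 4 f_equal.
  rewrite fmap_comp, comp_assoc, <- (comp_assoc (tau0 o)), mmul_assoc.
  rewrite comp_assoc, <- (comp_assoc _ (mmul T (T K))), <- mmul_nat.
  rewrite comp_assoc.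
  etransitivity; [exact (f_equal (fun h => h ∘ mmul T (T K)) H0)|].
  now rewrite <- (comp_assoc (tau0 o)), <- mmul_assoc, comp_assoc. }
intros [].
change (fmap T (idm K) ∘ (sqcap o ∘ mmul T K) ∘ fmap T (sqcap o ∘ mmul T K)
  = sqcap o ∘ mmul T K ∘ mmul T (T K)).
rewrite fmap_id, comp_idl, fmap_comp, comp_assoc.
(* Precomposing [H1] with [fmap T (mmul T K)] leaves only associativity of the multiplication. *)
etransitivity; [exact (f_equal (fun h => h ∘ fmap T (mmul T K)) H1)|].
rewrite <- !comp_assoc; f_equal; apply mmul_assoc.
Qed.

(** * (W1) and (W2) as 2-cell equations *)

(** As the identity 1-cell has trivial structure, the 2-cell component and the structure of the
    source enter both sides only through their composite, in which [tau0] absorbs ⊓. *)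
Lemma rcounit_mul_iff_2cell (X : M) :
  (mmul T X ∘ fmap T (rcounit_mul X) ∘ fmap T (munit T (X ⊗ T K))
     = rcounit_mul X)
  <-> (let V := tensor_TK_cell o in let W := id_cell T in
       let w := counitr_trans o in
       fmap W (mmul T X) ∘ cstr W (T X) ∘ fmap T (w (T X)) ∘ fmap T (cstr V X)
         ∘ fmap T (munit T (V X))
       = w (T X) ∘ cstr V X).
Proof.
cbn zeta; rewrite tensor_TK_cellE.
pose (w := runit (T X) ∘ (T X ◁ tau0 o)).
pose (s := (T X ◁ (sqcap o ∘ mmul T K)) ∘ tau o X (T K)).
assert (E : w ∘ s = rcounit_mul X).
{ unfold w, s, rcounit_mul.
  rewrite !comp_assoc, <- (comp_assoc (runit _)), <- thom_comp.
  now rewrite comp_idl, comp_assoc, tau0_sqcap. }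
change ((mmul T X ∘ fmap T (rcounit_mul X) ∘ fmap T (munit T (X ⊗ T K))
    = rcounit_mul X)
  <-> mmul T X ∘ idm (T (T X)) ∘ fmap T w ∘ fmap T s
        ∘ fmap T (munit T (X ⊗ T K)) = w ∘ s).
rewrite <- E, fmap_comp, comp_idr, !comp_assoc; apply iff_refl.
Qed.

Lemma lcounit_mul_iff_2cell (X : M) :
  (mmul T X ∘ fmap T (lcounit_mul X) ∘ fmap T (munit T (T K ⊗ X))
     = lcounit_mul X)
  <-> (let V := TK_tensor_cell o in let W := id_cell T in
       let w := counitl_trans o in
       fmap W (mmul T X) ∘ cstr W (T X) ∘ fmap T (w (T X)) ∘ fmap T (cstr V X)
         ∘ fmap T (munit T (V X))
       = w (T X) ∘ cstr V X).
Proof.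
cbn zeta; rewrite TK_tensor_cellE.
pose (w := lunit (T X) ∘ (tau0 o ▷ T X)).
pose (s := ((sqcap o ∘ mmul T K) ▷ T X) ∘ tau o (T K) X).
assert (E : w ∘ s = lcounit_mul X).
{ unfold w, s, lcounit_mul.
  rewrite !comp_assoc, <- (comp_assoc (lunit _)), <- thom_comp.
  now rewrite comp_idl, comp_assoc, tau0_sqcap. }
change ((mmul T X ∘ fmap T (lcounit_mul X) ∘ fmap T (munit T (T K ⊗ X))
    = lcounit_mul X)
  <-> mmul T X ∘ idm (T (T X)) ∘ fmap T w ∘ fmap T s
        ∘ fmap T (munit T (T K ⊗ X)) = w ∘ s).
rewrite <- E, fmap_comp, comp_idr, !comp_assoc; apply iff_refl.
Qed.

(** * Regrouping the composites in (W1)-(W4) *)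

Lemma W1_iff_rcounit_mul (X : M) :
  (mmul T X ∘ fmap T (runit (T X)) ∘ fmap T (T X ◁ tau0 o)
        ∘ fmap T (T X ◁ mmul T K) ∘ fmap T (tau o X (T K))
        ∘ fmap T (munit T (X ⊗ T K))
      = runit (T X) ∘ (T X ◁ tau0 o) ∘ (T X ◁ mmul T K) ∘ tau o X (T K))
  <-> mmul T X ∘ fmap T (rcounit_mul X) ∘ fmap T (munit T (X ⊗ T K))
      = rcounit_mul X.
Proof.
assert (E : rcounit_mul X
  = runit (T X) ∘ (T X ◁ tau0 o) ∘ (T X ◁ mmul T K) ∘ tau o X (T K)).
{ unfold rcounit_mul; f_equal.
  rewrite <- (comp_idl (idm (T X))), thom_comp, comp_idl.
  apply comp_assoc. }
rewrite E, !fmap_comp, !comp_assoc; apply iff_refl.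
Qed.

Lemma W2_iff_lcounit_mul (X : M) :
  (mmul T X ∘ fmap T (lunit (T X)) ∘ fmap T (tau0 o ▷ T X)
        ∘ fmap T (mmul T K ▷ T X) ∘ fmap T (tau o (T K) X)
        ∘ fmap T (munit T (T K ⊗ X))
      = lunit (T X) ∘ (tau0 o ▷ T X) ∘ (mmul T K ▷ T X) ∘ tau o (T K) X)
  <-> mmul T X ∘ fmap T (lcounit_mul X) ∘ fmap T (munit T (T K ⊗ X))
      = lcounit_mul X.
Proof.
assert (E : lcounit_mul X
  = lunit (T X) ∘ (tau0 o ▷ T X) ∘ (mmul T K ▷ T X) ∘ tau o (T K) X).
{ unfold lcounit_mul; f_equal.
  rewrite <- (comp_idl (idm (T X))), thom_comp, comp_idl.
  apply comp_assoc. }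
rewrite E, !fmap_comp, !comp_assoc; apply iff_refl.
Qed.

Lemma W3_lhsE (X Y Z : M) :
  ((T X ◁ mmul T Y) ▷ T Z) ∘ (tau o X (T Y) ▷ T Z)
    ∘ (munit T (X ⊗ T Y) ▷ T Z) ∘ assoc_inv X (T Y) (T Z)
    ∘ (X ◁ tau o Y Z) ∘ (X ◁ munit T (Y ⊗ Z)) ∘ assoc X Y Z
  = W3_lhs X Y Z.
Proof.
unfold W3_lhs, tauu; f_equal.
rewrite <- (comp_assoc _ (X ◁ tau o Y Z)), <- !thom_comp.
now rewrite !comp_idl, comp_assoc.
Qed.

Lemma W4_lhsE (X Y Z : M) :
  assoc_inv (T X) (T Y) (T Z) ∘ (T X ◁ (mmul T Y ▷ T Z))
    ∘ (T X ◁ tau o (T Y) Z) ∘ (T X ◁ munit T (T Y ⊗ Z))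
    ∘ assoc (T X) (T Y) Z ∘ (tau o X Y ▷ Z) ∘ (munit T (X ⊗ Y) ▷ Z)
  = W4_lhs X Y Z.
Proof.
unfold W4_lhs, tauu.
rewrite <- (comp_assoc _ (tau o X Y ▷ Z)), <- thom_comp, comp_idl; f_equal.
rewrite <- (comp_assoc _ (T X ◁ tau o (T Y) Z)), <- thom_comp.
rewrite <- (comp_assoc (assoc_inv _ _ _)), <- thom_comp.
now rewrite !comp_idl.
Qed.

End OpmonoidalMonadFacts.

Theorem theorem1p10 (M : monoidal_category) (T : monad M) (o : opmonoidal T) :
  ((forall X : M,
      mmul T X ∘ fmap T (runit (T X)) ∘ fmap T (T X ◁ tau0 o)
        ∘ fmap T (T X ◁ mmul T (tunit M)) ∘ fmap T (tau o X (T (tunit M)))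
        ∘ fmap T (munit T (X ⊗ T (tunit M)))
      = runit (T X) ∘ (T X ◁ tau0 o) ∘ (T X ◁ mmul T (tunit M))
        ∘ tau o X (T (tunit M)))
   /\
   (forall X : M,
      mmul T X ∘ fmap T (lunit (T X)) ∘ fmap T (tau0 o ▷ T X)
        ∘ fmap T (mmul T (tunit M) ▷ T X) ∘ fmap T (tau o (T (tunit M)) X)
        ∘ fmap T (munit T (T (tunit M) ⊗ X))
      = lunit (T X) ∘ (tau0 o ▷ T X) ∘ (mmul T (tunit M) ▷ T X)
        ∘ tau o (T (tunit M)) X)
   /\
   (forall X Y Z : M,
      ((T X ◁ mmul T Y) ▷ T Z) ∘ (tau o X (T Y) ▷ T Z)
        ∘ (munit T (X ⊗ T Y) ▷ T Z) ∘ assoc_inv X (T Y) (T Z)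
        ∘ (X ◁ tau o Y Z) ∘ (X ◁ munit T (Y ⊗ Z)) ∘ assoc X Y Z
      = (tau o X Y ▷ T Z) ∘ tau o (X ⊗ Y) Z ∘ munit T (X ⊗ Y ⊗ Z))
   /\
   (forall X Y Z : M,
      assoc_inv (T X) (T Y) (T Z) ∘ (T X ◁ (mmul T Y ▷ T Z))
        ∘ (T X ◁ tau o (T Y) Z) ∘ (T X ◁ munit T (T Y ⊗ Z))
        ∘ assoc (T X) (T Y) Z ∘ (tau o X Y ▷ Z) ∘ (munit T (X ⊗ Y) ▷ Z)
      = (tau o X Y ▷ T Z) ∘ tau o (X ⊗ Y) Z ∘ munit T (X ⊗ Y ⊗ Z))
   /\
   (forall X Y : M,
      (mmul T X ⊗₁ mmul T Y) ∘ tau o (T X) (T Y) ∘ fmap T (tau o X Y)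
      = tau o X Y ∘ mmul T (X ⊗ Y)))
  <->
  (is_1cell (unit_cell o)
   /\ is_1cell (tensor_cell o)
   /\ (is_2cell (counitr_trans o) /\ is_2cell (counitl_trans o))
   /\ (forall X Y Z : M,
         idemE_right o X Y Z ∘ (idemE o X Y ▷ T Z) = idemE3 o X Y Z
         /\ idemE3 o X Y Z = (idemE o X Y ▷ T Z) ∘ idemE_right o X Y Z)).
Proof.
split.
- intros (W1 & W2 & W3 & W4 & W5).
  (* Both source 1-cells of (iii) are built from (i) and (ii), so these two laws come first; (W1)
     enters (i) at the object [K]. *)
  assert (Hi : is_1cell (unit_cell o))
    by (apply unit_cell_of_W1, W1_iff_rcounit_mul, W1).
  assert (Hii : is_1cell (tensor_cell o)) by (intros [X Y]; apply W5).
  repeat split; auto using tensor_TK_1cell, TK_tensor_1cell, id_cell_1cell.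
  + intros X; apply rcounit_mul_iff_2cell, W1_iff_rcounit_mul, W1.
  + intros X; apply lcounit_mul_iff_2cell, W2_iff_lcounit_mul, W2.
  + revert X Y Z; apply W4_iff_idemE; intros X Y Z; rewrite <- W4_lhsE; apply W4.
  + symmetry; revert X Y Z; apply W3_iff_idemE; intros X Y Z.
    rewrite <- W3_lhsE; apply W3.
- intros (Hi & Hii & ((_ & _ & Hr) & (_ & _ & Hl)) & Hiv).
  repeat split.
  + intros X; apply W1_iff_rcounit_mul, rcounit_mul_iff_2cell, Hr.
  + intros X; apply W2_iff_lcounit_mul, lcounit_mul_iff_2cell, Hl.
  + intros X Y Z; rewrite W3_lhsE; revert X Y Z; apply W3_iff_idemE.
    intros X Y Z; symmetry; apply Hiv.
  + intros X Y Z; rewrite W4_lhsE; revert X Y Z; apply W4_iff_idemE.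
    intros X Y Z; apply Hiv.
  + intros X Y; exact (Hii (X, Y)).
Qed.
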